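(* Let $(T,X)$ be a semiflow on a compact Hausdorff space $X$ and let $x\in X$. Then $x$ is a distal point of $(T,X)$ if and only if $(x,y)$ is an almost periodic point of the product semiflow $(T,X\times X)$ for every almost periodic point $y$ of $(T,X)$.
   Context: $X$ is a nonempty compact Hausdorff space and $T$ is a discrete infinite semigroup with identity $e$. A semiflow $(T,X)$ is a continuous map $T\times X\to X$, $(t,x)\mapsto tx$, with $ex=x$ and $t(sx)=(ts)x$. $(T,X\times X)$ is the product semiflow $t(x,y)=(tx,ty)$. Points $x,y$ are proximal if there are a net $(t_n)$ in $T$ and $z\in X$ with $t_nx\to z$, $t_ny\to z$. $x$ is a distal point of $(T,X)$ if no point of $\overline{Tx}$ other than $x$ is proximal to $x$. A subset $A\subseteq T$ is right-syndetic if there is a compact (i.e. finite) $K\subseteq T$ with $Kt\cap A\ne\emptyset$ for every $t\in T$. A point $x$ is almost periodic for $(T,X)$ if $\{t\in T: tx\in U\}$ is right-syndetic in $T$ for every neighborhood $U$ of $x$. *)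

(* Defs.v *)
From HB Require Import structures.
From mathcomp Require Import all_boot.
From mathcomp Require Import all_classical.
From mathcomp Require Import topology.

Set Implicit Arguments.
Unset Strict Implicit.
Unset Printing Implicit Defensive.

Local Open Scope classical_set_scope.

#[short(type="discreteMonoidType")]
HB.structure Definition DiscreteMonoid :=
  {T of monoid.Monoid T & DiscreteTopology T}.

Record semiflow (T : discreteMonoidType) (X : topologicalType) := Semiflow {
  flow :> T -> X -> X;
  flow_continuous : continuous (fun p : T * X => flow p.1 p.2);
  flow1 : forall x, flow 1%g x = x;
  flowM : forall t s x, flow t (flow s x) = flow (t * s)%g x
}.

Section ProductSemiflow.
Variables (T : discreteMonoidType) (X : topologicalType) (phi : semiflow T X).

Definition prod_flow (t : T) (p : X * X) : X * X := (phi t p.1, phi t p.2).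

Lemma prod_flow_continuous :
  continuous (fun q : T * (X * X) => prod_flow q.1 q.2).
Proof.
move=> [t [x y]]; apply: cvg_pair => /=.
- apply: (@cvg_comp _ _ _ (fun q : T * (X * X) => (q.1, q.2.1))
    (fun p : T * X => phi p.1 p.2) _ (nbhs (t, x))).
    apply: cvg_pair; first exact: cvg_fst.
    exact: (cvg_comp _ _ cvg_snd cvg_fst).
  exact: (@flow_continuous _ _ phi (t, x)).
- apply: (@cvg_comp _ _ _ (fun q : T * (X * X) => (q.1, q.2.2))
    (fun p : T * X => phi p.1 p.2) _ (nbhs (t, y))).
    apply: cvg_pair; first exact: cvg_fst.
    exact: (cvg_comp _ _ cvg_snd cvg_snd).
  exact: (@flow_continuous _ _ phi (t, y)).
Qed.

Lemma prod_flow1 p : prod_flow 1%g p = p.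
Proof. by case: p => x y; rewrite /prod_flow /= !flow1. Qed.

Lemma prod_flowM t s p : prod_flow t (prod_flow s p) = prod_flow (t * s)%g p.
Proof. by rewrite /prod_flow /= !flowM. Qed.

Definition prod_semiflow : semiflow T (X * X)%type :=
  Semiflow prod_flow_continuous prod_flow1 prod_flowM.

End ProductSemiflow.

Record directedSet := DirectedSet {
  dir_sort :> Type;
  dir_le : dir_sort -> dir_sort -> Prop;
  dir_inhabited : [set: dir_sort] !=set0;
  dir_refl : forall i, dir_le i i;
  dir_trans : forall j i k, dir_le i j -> dir_le j k -> dir_le i k;
  dir_ub : forall i j, exists2 k, dir_le i k & dir_le j k
}.

(* A net u : I -> X converges to z iff u @ tails I --> z. *)
Definition tails (I : directedSet) : set_system I :=
  filter_from [set: I] (fun i => [set j | dir_le i j]).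
Arguments tails : clear implicits.

Section Dynamics.
Variables (T : discreteMonoidType) (X : topologicalType) (phi : semiflow T X).

Definition proximal (x y : X) : Prop :=
  exists (I : directedSet) (t : I -> T) (z : X),
    phi (t i) x @[i --> tails I] --> z /\
    phi (t i) y @[i --> tails I] --> z.

Definition orbit (x : X) : set X := range (fun t => phi t x).

Definition distal_point (x : X) : Prop :=
  forall y, closure (orbit x) y -> proximal y x -> y = x.

End Dynamics.

Definition right_syndetic (T : discreteMonoidType) (A : set T) : Prop :=
  exists2 K : set T, compact K &
    forall t, [set (k * t)%g | k in K] `&` A !=set0.

Definition almost_periodic (T : discreteMonoidType) (X : topologicalType)
    (phi : semiflow T X) (x : X) : Prop :=
  forall U, nbhs x U -> right_syndetic [set t | U (phi t x)].

(* Main.v *)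
(* Let E be the enveloping semigroup of (T,X), the closure of T in X^X for
   pointwise convergence. A point is almost periodic iff it lies in the orbit
   closure of each point of its own orbit closure. If x is distal and y is
   almost periodic, pick a minimal subset M of E; since M y contains y, the
   set of all p in M with p y = y is a nonempty compact semigroup, so it
   contains an idempotent u. Then u x is in the orbit closure of x and is
   proximal to x (since u (u x) = u x), hence u x = x, and (x,y) = (u x, u y)
   is almost periodic as the image of the almost periodic point u of E.
   Conversely, projecting (x,w) for any almost periodic w (one exists in a
   minimal set) shows that x is almost periodic, hence so is every y in its orbit
   closure; if moreover y is proximal to x then the orbit closure of (x,y)
   contains some (z,z), and so (x,y), returning from (z,z), is on the
   diagonal. *)
Require Import Defs.
From mathcomp Require Import all_boot.
From mathcomp Require Import all_classical.
From mathcomp Require Import topology.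

Set Implicit Arguments.
Unset Strict Implicit.

Local Open Scope classical_set_scope.

(** * Compactness, separation and minimal closed sets *)

Lemma compact_finite_subcover (Y : topologicalType) (A : set Y) (I : Type)
    (f : I -> set Y) :
  compact A -> (forall a, A a -> exists i, nbhs a (f i)) ->
  exists2 D, finite_set D & A `<=` \bigcup_(i in D) f i.
Proof.
move=> /compact_near_coveringP cA Af.
(* Along this filter, eventually means for all index sets containing some finite one; near-covering
   compactness then merges the local covers into a single finite [D]. *)
pose F := filter_from (@finite_set I) (fun D => [set E | D `<=` E]).
have FF : Filter F.
  apply: filter_from_filter; first by exists set0; exact: finite_set0.
  move=> D E fD fE; exists (D `|` E); first by rewrite finite_setU.
  by move=> G; rewrite /= subUset.
have [|D fD AD] := cA _ F (fun E y => (\bigcup_(i in E) f i) y) FF.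
  move=> a /Af[i fi]; exists (f i, [set E | E i]) => [|[b E] [/= fb Ei]].
    by split=> //; exists [set i]; [exact: finite_set1|move=> E; exact].
  by exists i.
by exists D => //; exact: AD.
Qed.

Lemma discrete_compact_finite (T : discreteTopologicalType) (K : set T) :
  compact K -> finite_set K.
Proof.
move=> /(@compact_finite_subcover T K T (fun k => [set k])) [|D fD KD].
  by move=> k _; exists k; exact: discrete_set1.
by apply: sub_finite_set fD => k /KD[i Di ->].
Qed.

Lemma hausdorff_prod (X Y : topologicalType) :
  hausdorff_space X -> hausdorff_space Y -> hausdorff_space (X * Y)%type.
Proof.
move=> hX hY [a b] [c d] cl; congr pair.
- apply: hX => U V Ua Vc.
  have [||z [/= Uz Vz]] := cl (fst @^-1` U) (fst @^-1` V).
  + exact: (cvg_fst (F := nbhs a) (G := nbhs b) Ua).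
  + exact: (cvg_fst (F := nbhs c) (G := nbhs d) Vc).
  + by exists z.1.
- apply: hY => U V Ub Vd.
  have [||z [/= Uz Vz]] := cl (snd @^-1` U) (snd @^-1` V).
  + exact: (cvg_snd (F := nbhs a) (G := nbhs b) Ub).
  + exact: (cvg_snd (F := nbhs c) (G := nbhs d) Vd).
  + by exists z.2.
Qed.

Lemma closed_diagonal (X : topologicalType) :
  hausdorff_space X -> closed [set p : X * X | p.1 = p.2].
Proof.
move=> hX [a b] cl; apply: hX => U V Ua Vb.
have [|[c d] [/= -> [/= Ud Vd]]] := cl (U `*` V); last by exists d.
by exists (U, V).
Qed.

Lemma closure_min (Y : topologicalType) (A B : set Y) :
  closed B -> A `<=` B -> closure A `<=` B.
Proof. by move=> /closure_id clB /closureS; rewrite -clB. Qed.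

(** Zorn's lemma, in its form for unions of chains, is applied to complements; compactness keeps
    intersections of chains nonempty. It serves twice: [P] is invariance for minimal sets of a
    semiflow, and stability under composition for minimal compact semigroups. *)
Lemma minimal_closed_subset (Y : topologicalType) (P : set (set Y)) (A : set Y) :
  compact [set: Y] ->
  (forall F : set (set Y), F `<=` P -> P (\bigcap_(B in F) B)) ->
  closed A -> P A -> A !=set0 ->
  exists M, [/\ M `<=` A, closed M, P M, M !=set0 &
    forall N, N `<=` M -> closed N -> P N -> N !=set0 -> N = M].
Proof.
move=> cY Pcap clA PA A0.
have PI B C : P B -> P C -> P (B `&` C).
  move=> PB PC; have -> : B `&` C = \bigcap_(D in [set B; C]) D.
    by rewrite bigcap_setU !bigcap_set1.
  by apply: Pcap => _ [] ->.
pose Q := [set U : set Y | [/\ closed (~` U), P (~` U) & (A `&` ~` U) !=set0]].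
have [F FQ totF|U [[clU PU U0] maxU]] := @Zorn_bigcup Y Q.
- have bigE : ~` (\bigcup_(U in F) U) = \bigcap_(B in [set ~` U | U in F]) B.
    by rewrite setC_bigcup bigcap_image.
  split; rewrite ?bigE.
  + by apply: closed_bigI => _ [U /FQ[? _ _] <-].
  + by apply: Pcap => _ [U /FQ[_ ? _] <-].
  + have [[U0 FU0]|F0] := pselect (F !=set0); last first.
      by case: A0 => a Aa; exists a; split => // _ [U FU <-]; case: F0; exists U.
    (* A cluster point of the traces on [A] of the chain lies in each of these closed sets. *)
    pose G := filter_from F (fun U => A `&` ~` U).
    have PG : ProperFilter G.
      apply: filter_from_proper; last by move=> U /FQ[].
      apply: filter_from_filter; first by exists U0.
      move=> U V FU FV; case: (totF U V FU FV) => UV.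
        by exists V => // z [Az Vz]; split; split => // /UV.
      by exists U => // z [Az Uz]; split; split => // /UV.
    have [z [_ Gz]] := cY G PG filterT.
    exists z; split.
      by apply: clA => W /Gz Wz; apply: Wz; exists U0 => // ? [].
    move=> _ [U FU <-]; have [clU _ _] := FQ _ FU.
    by apply: clU => W /Gz Wz; apply: Wz; exists U => // ? [].
- exists (A `&` ~` U); split => //.
  + exact: closedI.
  + exact: PI.
  + move=> N NU clN PN N0; apply/seteqP; split => // z [Az Uz].
    (* A point of [A] outside both [U] and [N] would make the complement of [N] strictly larger than
       the maximal [U]. *)
    apply: contrapT => Nz; apply: (maxU (~` N)).
      split; first by move=> w Uw Nw; have [] := NU _ Nw.
      by move=> /(_ z Nz).
    by split; rewrite setCK //; case: N0 => w Nw; exists w; split => //;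
       have [] := NU _ Nw.
Qed.

(** * Orbit closures, recurrence and proximality *)

Section SemiflowTheory.
Variables (T : discreteMonoidType) (Y : topologicalType) (psi : semiflow T Y).

Definition flow_invariant (A : set Y) := forall t y, A y -> A (psi t y).

Lemma flow_continuousr t : continuous (psi t).
Proof.
move=> y; apply: (@cvg_comp _ _ _ (fun y => (t, y))
  (fun p : T * Y => psi p.1 p.2) _ (nbhs (t, y))); last exact: (@flow_continuous _ _ psi (t, y)).
by apply: cvg_pair; [exact: cvg_cst|exact: cvg_id].
Qed.

Lemma orbit_refl y : closure (Defs.orbit psi y) y.
Proof. by apply: subset_closure; exists 1%g => //; rewrite flow1. Qed.

Lemma orbit_closure_invariant y : flow_invariant (closure (Defs.orbit psi y)).
Proof.
move=> t; apply: closure_min => [|_ [s _ <-]].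
  by apply: preimage_closed; [move=> ? _; exact: flow_continuousr|exact: closed_closure].
by apply: subset_closure; exists (t * s)%g => //; rewrite flowM.
Qed.

Lemma orbit_closure_min (A : set Y) y :
  closed A -> flow_invariant A -> A y -> closure (Defs.orbit psi y) `<=` A.
Proof. by move=> clA iA Ay; apply: closure_min => // _ [t _ <-]; exact: iA. Qed.

Lemma orbit_closure_trans a b c : closure (Defs.orbit psi a) b ->
  closure (Defs.orbit psi b) c -> closure (Defs.orbit psi a) c.
Proof.
move=> ab; apply: orbit_closure_min => //; first exact: closed_closure.
exact: orbit_closure_invariant.
Qed.

(** Equivalently, the orbit closure of [y] is a minimal set; this form is free of syndetic sets. *)
Definition uniformly_recurrent y :=
  forall a, closure (Defs.orbit psi y) a -> closure (Defs.orbit psi a) y.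

(** Forward: by regularity [U] contains a closed neighbourhood of [y]. Its preimages under the
    finitely many [k] in [K] form a closed set containing the orbit, hence also [a]. Backward: the
    preimages of [U] cover the compact orbit closure, and a finite subcover supplies the syndetic
    constant. *)
Lemma almost_periodicP y : compact [set: Y] -> hausdorff_space Y ->
  almost_periodic psi y <-> uniformly_recurrent y.
Proof.
move=> cY hY; split=> [apy a ya U Uy|ury U Uy].
- have [C Cy CU] := @compact_regular Y y setT hY cY filterT U Uy.
  have [K /discrete_compact_finite finK KC] := apy C Cy.
  pose B := \bigcup_(k in K) (psi k @^-1` closure C).
  have clB : closed B.
    apply: closed_bigcup => // k _.
    by apply: preimage_closed; [move=> ? _; exact: flow_continuousr|exact: closed_closure].
  have [|k Kk Ck] := closure_min clB _ ya.
    move=> _ [t _ <-]; have [_ [[k Kk <-] Ck]] := KC t.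
    by exists k => //=; apply: subset_closure; rewrite flowM.
  by exists (psi k a); split; [exists k|exact: CU].
- have cO : compact (closure (Defs.orbit psi y)).
    by apply: (subclosed_compact _ cY) => //; exact: closed_closure.
  have [|D fD DU] := compact_finite_subcover (f := fun t => psi t @^-1` U) cO.
    move=> a /ury /(_ _ (nbhs_interior Uy)) [_ [[t _ <-] Ut]].
    by exists t; exact: flow_continuousr.
  exists D; first exact: finite_compact.
  move=> t; have [|k Dk Uk] := DU (psi t y).
    by apply: subset_closure; exists t.
  by exists (k * t)%g; split; [exists k|rewrite /= -flowM].
Qed.

Lemma minimal_set (A : set Y) : compact [set: Y] ->
  closed A -> flow_invariant A -> A !=set0 ->
  exists M, [/\ M `<=` A, closed M, flow_invariant M, M !=set0 &
    forall p q, M p -> M q -> closure (Defs.orbit psi p) q].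
Proof.
move=> cY clA iA A0.
have [|M [MA clM iM M0 minM]] := minimal_closed_subset cY _ clA iA A0.
  by move=> F iF t y Fy B FB; apply: iF => //; exact: Fy.
exists M; split => // p q Mp; rewrite -(minM (closure (Defs.orbit psi p))) //.
- exact: orbit_closure_min.
- exact: closed_closure.
- exact: orbit_closure_invariant.
- by exists p; exact: orbit_refl.
Qed.

Lemma proximal_sym a b : proximal psi a b -> proximal psi b a.
Proof. by move=> [I [t [z [az bz]]]]; exists I, t, z. Qed.

(** Trades nets for an orbit closure in the product that meets the diagonal. *)
Lemma proximalP a b : proximal psi a b <->
  exists z, closure (Defs.orbit (prod_semiflow psi) (a, b)) (z, z).
Proof.
split=> [[I [t [z [az bz]]]]|[z abz]].
- exists z => W [[U V] [/= Uz Vz] UVW].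
  have [i _ Ui] := az _ Uz; have [j _ Vj] := bz _ Vz.
  have [k ik jk] := dir_ub i j.
  exists (psi (t k) a, psi (t k) b); split; first by exists (t k).
  by apply: UVW; split; [exact: Ui|exact: Vj].
(* An index is a neighbourhood of [(z, z)] together with a time carrying [(a, b)] into it, ordered
   by reverse inclusion of neighbourhoods. The net is then a projection, and no times have to be
   chosen. *)
- pose S := {tW : T * set (Y * Y) | nbhs (z, z) tW.2 /\ tW.2 (psi tW.1 a, psi tW.1 b)}.
  pose le (i j : S) := (sval j).2 `<=` (sval i).2.
  have ub W : nbhs (z, z) W -> exists i : S, (sval i).2 = W.
    move=> Wz; have [_ [[t _ <-] Wt]] := abz W Wz.
    by exists (exist _ (t, W) (conj Wz Wt)).
  have S0 : [set: S] !=set0 by have [i _] := ub setT filterT; exists i.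
  have leT (j i k : S) : le i j -> le j k -> le i k by move=> ij jk ? /jk /ij.
  have leU (i j : S) : exists2 k, le i k & le j k.
    have [k kE] := ub _ (filterI (svalP i).1 (svalP j).1).
    by exists k; rewrite /le kE => ? [].
  exists (DirectedSet S0 (fun i => @subset_refl _ _) leT leU), (fun i => (sval i).1), z.
  split=> U Uz.
  + have [i iE] := ub _ (cvg_fst (F := nbhs z) (G := nbhs z) Uz).
    by exists i => // j; rewrite /= /le iE => /(_ _ (svalP j).2).
  + have [i iE] := ub _ (cvg_snd (F := nbhs z) (G := nbhs z) Uz).
    by exists i => // j; rewrite /= /le iE => /(_ _ (svalP j).2).
Qed.

End SemiflowTheory.

(** * Images under continuous equivariant maps *)

Section FlowMorphisms.
Variables (T : discreteMonoidType) (Y Z : topologicalType).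
Variables (psi : semiflow T Y) (chi : semiflow T Z) (f : Y -> Z).
Hypotheses (f_continuous : continuous f)
  (f_flow : forall t y, f (psi t y) = chi t (f y)).

Lemma orbit_closure_image p q : closure (Defs.orbit psi p) q ->
  closure (Defs.orbit chi (f p)) (f q).
Proof.
apply: (@closure_min _ _ (f @^-1` closure (Defs.orbit chi (f p)))).
  by apply: preimage_closed; [move=> ? _; exact: f_continuous|exact: closed_closure].
by move=> _ [t _ <-]; rewrite /preimage /= f_flow; apply: subset_closure; exists t.
Qed.

(** The image of the compact orbit closure of [p] is closed and invariant, so each point of the
    orbit closure of [f p] lifts to some [q] in that of [p]; the return from [q] to [p] is then
    pushed forward. *)
Lemma uniformly_recurrent_image p : compact [set: Y] -> hausdorff_space Z ->
  uniformly_recurrent psi p -> uniformly_recurrent chi (f p).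
Proof.
move=> cY hZ rp a pa.
have cO : compact (f @` closure (Defs.orbit psi p)).
  apply: continuous_compact; first exact: continuous_subspaceT.
  exact: (subclosed_compact (@closed_closure _ _) cY (@subsetT _ _)).
have [||q pq <-] := orbit_closure_min (compact_closed hZ cO) _ _ pa.
- move=> t _ [q pq <-]; exists (psi t q) => //; exact: orbit_closure_invariant.
- by exists p => //; exact: orbit_refl.
- exact/orbit_closure_image/rp.
Qed.

End FlowMorphisms.

(** * The compact semigroup of all self-maps and its idempotents *)

Section PointwiseConvergence.
Variable X : topologicalType.
Local Notation maps := {ptws X -> X}.

Lemma ptws_eval_continuous (x : X) : continuous (fun p : maps => p x).
Proof. exact: (@proj_continuous X (fun=> X) x). Qed.

Lemma ptws_continuous (Z : topologicalType) (f : Z -> maps) :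
  (forall x, continuous (fun z => f z x)) -> continuous f.
Proof.
move=> fc z; apply/cvg_sup => x.
by apply/continuous_comp_initial: z => z; exact: fc.
Qed.

Lemma ptws_compact : compact [set: X] -> compact [set: maps].
Proof.
move=> cX; have := @tychonoff X (fun=> X) (fun=> setT) (fun=> cX).
by congr compact; apply/seteqP.
Qed.

Lemma ptws_hausdorff : hausdorff_space X -> hausdorff_space maps.
Proof. by move=> hX; exact: (@hausdorff_product X (fun=> X)). Qed.

(** Composing on the right only reindexes coordinates, so [q] may be discontinuous. Composition on
    the left lacks this property, and all arguments below rest on this one side. *)
Lemma precomp_continuous (q : maps) : continuous (fun p : maps => (p \o q : maps)).
Proof. by apply: ptws_continuous => x; exact: (@ptws_eval_continuous (q x)). Qed.

Definition eval_pair (a b : X) (p : maps) : X * X := (p a, p b).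

Lemma eval_pair_continuous a b : continuous (eval_pair a b).
Proof.
move=> p; apply: (@cvg_pair _ _ _ (nbhs p) (nbhs (p a)) (nbhs (p b)) _ _ _
  (fun q : maps => q a) (fun q => q b)); exact: ptws_eval_continuous.
Qed.

Definition comp_closed (A : set maps) := forall p q, A p -> A q -> A (p \o q).

(** For [u] in a minimal closed semigroup [M], the closed semigroup of all [p \o u] with [p] in [M]
    is [M] itself, so some [p] in [M] fixes [u] from the left. The set [S] of such [p] is again a
    closed semigroup, hence equals [M] and contains [u]. *)
Lemma ellis_numakura (A : set maps) : compact [set: X] -> hausdorff_space X ->
  closed A -> comp_closed A -> A !=set0 -> exists2 u, A u & u \o u = u.
Proof.
move=> /ptws_compact cY /ptws_hausdorff hY clA sA A0.
have [|M [MA clM sM [u Mu] minM]] :=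
    minimal_closed_subset cY _ clA sA A0.
  by move=> F sF p q Fp Fq B FB; apply: sF => //; [exact: Fp|exact: Fq].
pose Mu' : set maps := (fun p : maps => (p \o u : maps)) @` M.
have MuE : Mu' = M.
  apply: minM.
  - by move=> _ [p Mp <-]; exact: sM.
  - apply: compact_closed => //; apply: continuous_compact.
      by apply: continuous_subspaceT; exact: precomp_continuous.
    exact: (subclosed_compact clM cY (@subsetT _ _)).
  - move=> _ _ [p Mp <-] [q Mq <-]; exists (p \o (u \o q)) => //.
    by apply: (sM) => //; exact: sM.
  - by exists (u \o u), u.
have [p Mp pu] : Mu' u by rewrite MuE.
pose S : set maps := M `&` [set p : maps | p \o u = u].
have SE : S = M.
  apply: minM.
  - by move=> ? [].
  - apply: closedI => //.
    have -> : [set p : maps | p \o u = u] =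
        (fun p : maps => (p \o u : maps)) @^-1` [set u] by [].
    apply: preimage_closed; first by move=> ? _; exact: precomp_continuous.
    by apply: compact_closed => //; exact: compact_set1.
  - move=> a b [Ma au] [Mb bu]; split; first exact: sM.
    by rewrite /= -compA bu au.
  - by exists p.
have [_ uu] : S u by rewrite SE.
by exists u => //; exact: MA.
Qed.

End PointwiseConvergence.

(** * The enveloping semigroup and its minimal sets *)

Section EnvelopingSemigroup.
Variables (T : discreteMonoidType) (X : topologicalType) (phi : semiflow T X).
Local Notation maps := {ptws X -> X}.

Definition post_flow (t : T) (p : maps) : maps := phi t \o p.

Lemma post_flow_continuous : continuous (fun q : T * maps => post_flow q.1 q.2).
Proof.
apply: ptws_continuous => x [t p].
apply: (@cvg_comp _ _ _ (fun q : T * maps => (q.1, q.2 x))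
  (fun p : T * X => phi p.1 p.2) _ (nbhs (t, p x))).
  apply: cvg_pair; first exact: cvg_fst.
  apply: (@cvg_comp _ _ _ snd (fun p : maps => p x)); first exact: cvg_snd.
  exact: ptws_eval_continuous.
exact: (@flow_continuous _ _ phi (t, p x)).
Qed.

Lemma post_flow1 p : post_flow 1%g p = p.
Proof. by apply/funext => x; exact: flow1. Qed.

Lemma post_flowM t s p : post_flow t (post_flow s p) = post_flow (t * s)%g p.
Proof. by apply/funext => x; exact: flowM. Qed.

Definition post_semiflow : semiflow T maps :=
  Semiflow post_flow_continuous post_flow1 post_flowM.

Definition enveloping : set maps := closure (Defs.orbit post_semiflow idfun).

(** The maps [p] with [p \o q] in [A] form a closed set containing the orbit of the identity. In
    particular, minimal sets inside the enveloping semigroup are left ideals. *)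
Lemma enveloping_comp (A : set maps) p q :
  closed A -> flow_invariant post_semiflow A ->
  enveloping p -> A q -> A (p \o q).
Proof.
move=> clA iA Ep Aq; apply: (@closure_min _ _ ((fun p : maps => (p \o q : maps)) @^-1` A) _ _ _ Ep).
  by apply: preimage_closed => // ? _; exact: precomp_continuous.
by move=> _ [t _ <-]; exact: iA.
Qed.

Lemma eval_orbit_closure a p q : closure (Defs.orbit post_semiflow p) q ->
  closure (Defs.orbit phi (p a)) (q a).
Proof.
exact: (orbit_closure_image (f := fun p : maps => p a)
  (@ptws_eval_continuous X a)).
Qed.

Lemma eval_pair_flow a b t (p : maps) :
  eval_pair a b (post_semiflow t p) = prod_semiflow phi t (eval_pair a b p).
Proof. by []. Qed.

Lemma eval_pair_orbit_closure a b p q :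
  closure (Defs.orbit post_semiflow p) q ->
  closure (Defs.orbit (prod_semiflow phi) (eval_pair a b p)) (eval_pair a b q).
Proof.
exact: (orbit_closure_image (@eval_pair_continuous X a b) (eval_pair_flow a b)).
Qed.

Lemma enveloping_idempotent y : compact [set: X] -> hausdorff_space X ->
  uniformly_recurrent phi y ->
  exists u : maps, [/\ enveloping u, u y = y, u \o u = u &
    uniformly_recurrent post_semiflow u].
Proof.
move=> cX hX ry.
have cY := ptws_compact cX.
have [||M [ME clM iM [p0 Mp0] minM]] :=
    minimal_set (psi := post_semiflow) (A := enveloping) cY (@closed_closure _ _).
- exact: orbit_closure_invariant.
- by exists idfun; exact: orbit_refl.
(* Recurrence of [y] allows a return from [p0 y] to [y], and the orbit closure of [p0 y] stays
   inside the closed invariant set of values at [y] of maps in [M]. *)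
have [p Mp py] : exists2 p : maps, M p & p y = y.
  have yp0 := ry _ (eval_orbit_closure (a := y) (ME _ Mp0)).
  have cM : compact ((fun p : maps => p y) @` M).
    apply: continuous_compact; last exact: (subclosed_compact clM cY (@subsetT _ _)).
    by apply: continuous_subspaceT; exact: ptws_eval_continuous.
  apply: (orbit_closure_min (compact_closed hX cM) _ _ yp0).
    by move=> t _ [p Mp <-]; exists (post_semiflow t p) => //; exact: iM.
  by exists p0.
have [|||u [Mu uy] uu] := ellis_numakura
    (A := M `&` [set p : maps | p y = y]) cX hX.
- apply: closedI => //.
  apply: (@preimage_closed _ _ (fun p : maps => p y) [set y]).
    by move=> ? _; exact: ptws_eval_continuous.
  by apply: compact_closed => //; exact: compact_set1.
- move=> a b [Ma ay] [Mb bee]; split; last by rewrite /= bee.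
  exact: (enveloping_comp clM iM (ME _ Ma)).
- by exists p.
exists u; split => //; first exact: ME.
(* Minimality of [M], which contains [u], makes [u] recurrent. *)
move=> q uq; apply: minM => //.
exact: (orbit_closure_min clM iM Mu uq).
Qed.

End EnvelopingSemigroup.

(** * Distality expressed through almost periodic pairs *)

Unset Implicit Arguments.

Theorem theorem5p1 (T : discreteMonoidType) (X : topologicalType)
    (phi : semiflow T X) (x : X)
    (T_infinite : infinite_set [set: T])
    (X_compact : compact [set: X]) (X_hausdorff : hausdorff_space X) :
  distal_point phi x <->
  forall y : X, almost_periodic phi y ->
    almost_periodic (prod_semiflow phi) (x, y).
Proof.
have XX_compact : compact [set: X * X].
  by rewrite -setXTT; exact: compact_setX.
have XX_hausdorff := hausdorff_prod X_hausdorff X_hausdorff.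
have apX y := almost_periodicP phi y X_compact X_hausdorff.
have apXX p := almost_periodicP (prod_semiflow phi) p XX_compact XX_hausdorff.
split=> [dx y /apX ry|apx y xy /proximal_sym/proximalP[z xyz]].
- have [u [Eu uy uu ru]] := enveloping_idempotent X_compact X_hausdorff ry.
  have ux : u x = x.
    apply: dx; first exact: (eval_orbit_closure (a := x) Eu).
    (* Applying [u] to the pair [(u x, x)] yields [(u (u x), u x)], which is diagonal by
       idempotence. *)
    apply/proximalP; exists (u x).
    have := eval_pair_orbit_closure (a := u x) (b := x) Eu.
    by rewrite /eval_pair -[u (u x)]/((u \o u) x) uu.
  apply/apXX; have := uniformly_recurrent_image (@eval_pair_continuous X x y)
    (eval_pair_flow phi x y) (ptws_compact X_compact) XX_hausdorff ru.
  by rewrite /eval_pair ux uy.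
- have [||M [_ clM iM [w Mw] minM]] :=
      minimal_set (psi := phi) (A := setT) X_compact closedT => //.
    by exists x.
  have apw : almost_periodic phi w.
    by apply/apX => a wa; apply: minM => //; exact: (orbit_closure_min clM iM Mw).
  have rx : uniformly_recurrent phi x.
    have /apXX := apx _ apw.
    apply: (uniformly_recurrent_image (f := fst) _ _ XX_compact X_hausdorff) => //.
    by move=> p; exact: cvg_fst.
  (* From any [a] in the orbit closure of [y], recurrence of [x] leads back to [x], and from there
     to [y]. *)
  have ry : uniformly_recurrent phi y.
    move=> a ya; apply: (orbit_closure_trans _ xy); apply: rx.
    exact: orbit_closure_trans xy ya.
  have /apXX rxy := apx y (proj2 (apX y) ry).
  (* The diagonal is closed and invariant, so it contains the orbit closure of [(z, z)], to which
     [(x, y)] belongs by recurrence. *)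
  have /= -> // := orbit_closure_min (closed_diagonal X_hausdorff) _ _ (rxy _ xyz).
  by move=> t p; rewrite /= => ->.
Qed.
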